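(* Let $(T,X)$ and $(T,Y)$ be two minimal invertible semiflows on compact Hausdorff spaces with $T$ an amenable semigroup. If $\varphi:(T,X)\to(T,Y)$ is a relatively equicontinuous extension and $(T,Y)$ is point-distal, then $(T,X)$ is a point-distal semiflow. In fact, if $y\in Y$ is a distal point of $(T,Y)$, then each point of $\varphi^{-1}(y)$ is a distal point of $(T,X)$.
   Context: $X,Y$ are nonempty compact Hausdorff spaces, $\mathscr U_X$ is the compatible uniformity of $X$ (symmetric entourages), and $T$ is a discrete infinite semigroup with identity $e$. A semiflow $(T,X)$ is a continuous map $T\times X\to X$, $(t,x)\mapsto tx$, with $ex=x$ and $t(sx)=(ts)x$. It is invertible if for every $t\in T$ the map $x\mapsto tx$ is a bijection of $X$; minimal if $Tx=\{tx:t\in T\}$ is dense in $X$ for every $x$. A discrete semigroup $T$ is amenable if every semiflow $(T,Z)$ with phase semigroup $T$ on a nonempty compact Hausdorff space $Z$ admits an invariant Borel probability measure, i.e. a Borel probability measure $\mu$ on $Z$ with $\mu(B)=\mu(t^{-1}B)$ for all $t\in T$ and all Borel sets $B\subseteq Z$, where $t^{-1}B=\{z\in Z: tz\in B\}$. Points $x,x'$ are proximal if there are a net $(t_n)$ in $T$ and $z$ with $t_nx\to z$, $t_nx'\to z$. $x$ is a distal point of $(T,X)$ if no point of $\overline{Tx}$ other than $x$ is proximal to $x$. $(T,X)$ is point-distal if there is a distal point $x$ with $Tx$ dense in $X$. A relatively equicontinuous extension $\varphi:(T,X)\to(T,Y)$ is a continuous surjection $\varphi:X\to Y$ with $\varphi(tx)=t\varphi(x)$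 for all $t,x$, such that for every $\varepsilon\in\mathscr U_X$ there is $\delta\in\mathscr U_X$ such that $(x,x')\in\delta$ and $\varphi(x)=\varphi(x')$ imply $(tx,tx')\in\varepsilon$ for all $t\in T$. *)

(* Defs.v *)
From HB Require Import structures.
From mathcomp Require Import all_boot all_order all_algebra.
From mathcomp Require Import all_classical all_reals all_analysis.

Set Implicit Arguments.
Unset Strict Implicit.
Unset Printing Implicit Defensive.

Local Open Scope classical_set_scope.

(* A discrete semigroup with identity is a [monoidType]; its topology is the
   one of the alias [discrete_topology T]. *)
Record semiflow (T : monoidType) (X : topologicalType) := Semiflow {
  sf_act :> T -> X -> X;
  sf_continuous :
    continuous (fun p : discrete_topology T * X => sf_act p.1 p.2);
  sf_act1 : forall x, sf_act 1%g x = x;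
  sf_actM : forall t s x, sf_act t (sf_act s x) = sf_act (t * s)%g x
}.

Definition sf_orbit (T : monoidType) (X : topologicalType)
    (f : semiflow T X) (x : X) : set X := range (fun t => f t x).

Definition sf_invertible (T : monoidType) (X : topologicalType)
    (f : semiflow T X) : Prop := forall t, bijective (f t).

Definition sf_minimal (T : monoidType) (X : topologicalType)
    (f : semiflow T X) : Prop := forall x, dense (sf_orbit f x).

(* [g_sigma_algebraType open] is [Z] with its Borel sigma-algebra.
   Nonemptiness of [Z] is built into [ptopologicalType], since measurable
   types are pointed; the distinguished point plays no other role. *)
Definition amenable (R : realType) (T : monoidType) : Prop :=
  forall (Z : ptopologicalType) (f : semiflow T Z),
    compact [set: Z] -> hausdorff_space Z ->
    exists mu : probability (g_sigma_algebraType (@open Z)) R,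
      forall (t : T) (B : set (g_sigma_algebraType (@open Z))),
        measurable B -> mu B = mu (f t @^-1` B).

Definition directed_preorder (I : Type) (le : I -> I -> Prop) : Prop :=
  [/\ inhabited I,
      forall i, le i i,
      forall i j k, le i j -> le j k -> le i k &
      forall i j, exists k, le i k /\ le j k].

(* Convergence of a net indexed by [I] is convergence along its tails. *)
Definition net_tails (I : Type) (le : I -> I -> Prop) : set_system I :=
  filter_from [set: I] (fun i => [set j | le i j]).

Definition proximal (T : monoidType) (X : topologicalType)
    (f : semiflow T X) (x x' : X) : Prop :=
  exists (I : Type) (le : I -> I -> Prop) (t : I -> T) (z : X),
    [/\ directed_preorder le,
        f (t i) x @[i --> net_tails le] --> z &
        f (t i) x' @[i --> net_tails le] --> z].

Definition distal_point (T : monoidType) (X : topologicalType)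
    (f : semiflow T X) (x : X) : Prop :=
  forall x', closure (sf_orbit f x) x' -> x' <> x -> ~ proximal f x' x.

Definition point_distal (T : monoidType) (X : topologicalType)
    (f : semiflow T X) : Prop :=
  exists x, distal_point f x /\ dense (sf_orbit f x).

Definition sym_entourage (X : uniformType) (E : set (X * X)) : Prop :=
  entourage E /\ (E^-1)%relation = E.

(* The compatible uniformity of a compact Hausdorff space is unique, so it is
   the one carried by [X : uniformType]. *)
Record rel_equicontinuous_extension (T : monoidType) (X : uniformType)
    (Y : topologicalType) (fX : semiflow T X) (fY : semiflow T Y)
    (phi : X -> Y) : Prop := RelEquicontinuousExtension {
  ree_continuous : continuous phi;
  ree_surjective : set_surj [set: X] [set: Y] phi;
  ree_equivariant : forall t x, phi (fX t x) = fY t (phi x);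
  ree_equicontinuous : forall E : set (X * X), sym_entourage E ->
    exists D : set (X * X), sym_entourage D /\
      forall x x' : X, D (x, x') -> phi x = phi x' ->
        forall t, E (fX t x, fX t x')
}.

(* Main.v *)
(* Let [x'] be proximal to [x], with [phi x] distal; then both lie in one fibre.
   Fix [t] in [T] and let [g = t^-1].  Ellis' idempotent lemma in [X^X] gives
   idempotent limits [u] of positive powers of [t] and [q] of positive powers
   of [g] with [q u = u].  Distality makes [u], hence [q], preserve the fibre.
   If [g^n z] and [g^n z'] are close, equicontinuity along [t^n] makes [z] and
   [z'] close; so the idempotent [q] is injective on the fibre, that is, the
   identity there.  Hence [t x] and [t x'] are limits of [t g^n x] and
   [t g^n x'] along one net, and applying [t^(n-1)] shows that [x] and [x'] are
   close as soon as [t x] and [t x'] are, uniformly in [t].  By proximality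
   [x = x']. *)
Require Import Defs.
From mathcomp Require Import all_boot all_order all_algebra.
From mathcomp Require Import all_classical all_reals all_analysis.

Set Implicit Arguments.
Unset Strict Implicit.
Unset Printing Implicit Defensive.

Local Open Scope classical_set_scope.

(** * Compactness and minimal closed sets *)

Lemma closure_sub_preimage (U V : topologicalType) (f : U -> V)
    (A : set U) (B : set V) :
  continuous f -> closed B -> A `<=` f @^-1` B -> closure A `<=` f @^-1` B.
Proof.
move=> fc Bc AB; rewrite closureE; apply: smallest_sub => //.
exact: (continuous_closedP _).1.
Qed.

Lemma compact_directed_bigcap (S : topologicalType) (F : set (set S)) :
  compact [set: S] -> F !=set0 ->
  (forall A B, F A -> F B -> exists2 C, F C & C `<=` A `&` B) ->
  (forall A, F A -> closed A) -> (forall A, F A -> A !=set0) ->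
  \bigcap_(A in F) A !=set0.
Proof.
move=> cS F0 Fdir Fcl Fne.
pose G := filter_from F id.
have GF : ProperFilter G.
  apply: filter_from_proper => //; apply: filter_from_filter => //.
have [p [_ Gp]] := cS G GF filterT.
exists p => A FA; apply: Fcl => // B pB.
by apply: Gp => //; exists A.
Qed.

(** [P] stays abstract because it serves twice: for subsemigroups of [X^X], and for sets stable
    under composition with a fixed map. *)
Lemma compact_minimal (S : topologicalType) (P : set (set S)) (A : set S) :
  compact [set: S] ->
  (forall F : set (set S), F `<=` P -> P (\bigcap_(B in F) B)) ->
  closed A -> A !=set0 -> P A ->
  exists B, [/\ closed B, B !=set0, P B, B `<=` A &
    forall C, closed C -> C !=set0 -> P C -> C `<=` B -> C = B].
Proof.
move=> cS PI Acl A0 PA.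
(* [Zorn_bigcup] works with unions of chains, so it is applied to the part [U] removed from [A]. *)
pose Q U := [/\ closed (A `\` U), A `\` U !=set0 & P (A `\` U)].
have [F FQ Ftot|U [[Ucl U0 PU] Umax]] := @Zorn_bigcup S Q.
  have [->|/set0P F0] := eqVneq F set0.
    by rewrite bigcup_set0 /Q setD0.
  pose G := [set A `\` U | U in F].
  have -> : Q (\bigcup_(U in F) U) =
      [/\ closed (\bigcap_(B in G) B), \bigcap_(B in G) B !=set0 &
          P (\bigcap_(B in G) B)].
    rewrite /Q; suff -> : A `\` \bigcup_(U in F) U = \bigcap_(B in G) B by [].
    apply/seteqP; split => [x [Ax nUx] _ [U FU <-]|x GUx].
      by split => // Ux; apply: nUx; exists U.
    have [U0 FU0] := F0.
    split; first by have [] := GUx (A `\` U0) (ex_intro2 _ _ U0 FU0 erefl).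
    by move=> [U FU Ux]; have [] := GUx (A `\` U) (ex_intro2 _ _ U FU erefl).
  split.
  - by apply: closed_bigI => _ [U FU <-]; have [] := FQ U FU.
  - apply: compact_directed_bigcap => //.
    + by have [U FU] := F0; exists (A `\` U); exists U.
    + move=> _ _ [U FU <-] [V FV <-].
      have [UV|VU] := Ftot _ _ FU FV.
        by exists (A `\` V); [exists V|move=> x [Ax nV]; split; split => // /UV].
      by exists (A `\` U); [exists U|move=> x [Ax nU]; split; split => // /VU].
    + by move=> _ [U FU <-]; have [] := FQ U FU.
    + by move=> _ [U FU <-]; have [] := FQ U FU.
  - by apply: PI => _ [U FU <-]; have [] := FQ U FU.
exists (A `\` U); split => // C Ccl C0 PC CAU.
apply/seteqP; split => // x [Ax nUx]; apply: contrapT => nCx.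
have CA : A `\` (A `\` C) = C.
  by rewrite setDD setIidr// => y /CAU[].
(* Removing the complement of [C] as well leaves exactly [C], and adds [x] to what is removed. *)
apply: (Umax (U `|` (A `\` C))); last first.
  rewrite /Q; have -> : A `\` (U `|` A `\` C) = C; last by [].
  apply/seteqP; split => [y [Ay ny]|y Cy].
    by apply: contrapT => nCy; apply: ny; right.
  have [Ay nUy] := CAU y Cy; split => //.
  by move=> [//|[_]]; apply.
split; first by left.
by move=> /(_ x) H; apply: nUx; apply: H; right.
Qed.

(** The preimage of a closed set under [g] is its image under [t], which is compact and hence
    closed. *)
Lemma can_continuous_compact (X Y : topologicalType) (t : X -> Y) (g : Y -> X) :
  compact [set: X] -> hausdorff_space Y -> continuous t ->
  cancel t g -> cancel g t -> continuous g.
Proof.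
move=> cX hY tc tK gK; apply/continuous_closedP => D Dcl.
have -> : g @^-1` D = t @` D.
  apply/seteqP; split => [x Dx|_ [x Dx <-]]; last by rewrite /preimage /= tK.
  by exists (g x).
apply: compact_closed => //; apply: continuous_compact.
  exact: continuous_subspaceT.
exact: subclosed_compact cX _.
Qed.

(** * Idempotents among the self-maps of [X], with pointwise convergence *)

Section pointwise_maps.
Variable X : topologicalType.
Hypotheses (cX : compact [set: X]) (hX : hausdorff_space X).
Local Notation E := {ptws X -> X}.

Lemma ptws_eval_continuous (x : X) : continuous (fun f : E => f x).
Proof. exact: (@proj_continuous X (fun=> X) x). Qed.

Lemma ptws_nbhs_eval (f : E) (x : X) (U : set X) :
  nbhs (f x) U -> nbhs f [set p : E | U (p x)].
Proof. exact: ptws_eval_continuous. Qed.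

Lemma ptws_continuous (Z : topologicalType) (h : Z -> E) :
  (forall x, continuous (fun z => h z x)) -> continuous h.
Proof.
move=> hc z; apply/cvg_sup => x.
move=> A /= [B [[C oC <-] Bz] BA].
apply: filterS BA _; apply: (hc x z).
by apply: open_nbhs_nbhs; split.
Qed.

Lemma ptws_compact : compact [set: E].
Proof.
have -> : [set: E] = [set f : E | forall i, [set: X] (f i)].
  by apply/seteqP; split.
exact: (@tychonoff X (fun=> X) (fun=> setT) (fun=> cX)).
Qed.

Lemma ptws_hausdorff : hausdorff_space E.
Proof. exact: (@hausdorff_product X (fun=> X)). Qed.

(** Here [p] may be discontinuous, whereas left composition needs a continuous map. So limits may be
    taken freely only in the left factor. *)
Lemma ptws_precomp_continuous (p : E) :
  continuous (fun f : E => (f \o p : E)).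
Proof. by apply: ptws_continuous => x; exact: ptws_eval_continuous. Qed.

Lemma ptws_postcomp_continuous (t : X -> X) : continuous t ->
  continuous (fun f : E => (t \o f : E)).
Proof.
move=> tc; apply: ptws_continuous => x f.
apply: (@continuous_comp _ _ _ (fun f : E => f x) t); last exact: tc.
exact: ptws_eval_continuous.
Qed.

Lemma ptws_closed_image (h : E -> E) (A : set E) :
  continuous h -> closed A -> closed (h @` A).
Proof.
move=> hc Acl; apply: compact_closed; first exact: ptws_hausdorff.
apply: continuous_compact; first exact: continuous_subspaceT.
exact: subclosed_compact ptws_compact _.
Qed.

Lemma ptws_closed_set1 (f : E) : closed [set f].
Proof.
by apply: compact_closed; [exact: ptws_hausdorff|exact: compact_set1].
Qed.

(** In a minimal closed subsemigroup [B], the closed subsemigroup [B u] is all of [B]. So the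
    elements [p] of [B] with [p u = u] form a nonempty closed subsemigroup, again all of [B], and
    [u] is among them. *)
Lemma ellis_idempotent (A : set E) :
  closed A -> A !=set0 -> (forall p q, A p -> A q -> A (p \o q)) ->
  exists2 u, A u & u \o u = u.
Proof.
move=> Acl A0 AM.
pose P (B : set E) := forall p q, B p -> B q -> B (p \o q).
have PI (F : set (set E)) : F `<=` P -> P (\bigcap_(B in F) B).
  by move=> FP p q Fp Fq B FB; apply: (FP B FB); [apply: Fp|apply: Fq].
have [B [Bcl [u Bu] PB BA Bmin]] := compact_minimal ptws_compact PI Acl A0 AM.
have Bu_eq : (fun f : E => (f \o u : E)) @` B = B.
  apply: Bmin.
  - by apply: ptws_closed_image => //; exact: ptws_precomp_continuous.
  - by exists (u \o u); exists u.
  - move=> _ _ [p Bp <-] [q Bq <-]; exists (p \o u \o q) => //.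
    exact: (PB _ _ (PB _ _ Bp Bu) Bq).
  - by move=> _ [p Bp <-]; exact: PB.
have Fix_eq : B `&` (fun f : E => (f \o u : E)) @^-1` [set u] = B.
  apply: Bmin.
  - apply: closedI => //; apply: (continuous_closedP _).1; last exact: ptws_closed_set1.
    exact: ptws_precomp_continuous.
  - by have := Bu; rewrite -{1}Bu_eq => -[b Bb bu]; exists b.
  - move=> p q [Bp pu] [Bq qu]; split; first exact: PB.
    rewrite /preimage /= in pu qu *.
    by rewrite -[LHS]/(p \o (q \o u)) qu.
  - by move=> p [].
exists u; first exact: BA.
by have := Bu; rewrite -{1}Fix_eq => -[].
Qed.

(* The left ideal [L] is minimal for [t], hence also for [g = t^-1]; thus [u]
   is a limit of [g^n \o u], and any [q] realizing this limit fixes [u]. *)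
Lemma inverse_idempotents (t g : X -> X) :
  continuous t -> cancel t g -> cancel g t ->
  exists u q : E,
    [/\ closure (range (fun n => iter n.+1 t : E)) u,
        closure (range (fun n => iter n.+1 g : E)) q,
        u \o u = u, q \o q = q & q \o u = u].
Proof.
move=> tc tK gK.
have gc : continuous g by exact: can_continuous_compact cX hX tc tK gK.
pose Ep := closure (range (fun n => iter n.+1 t : E)).
pose Em := closure (range (fun n => iter n.+1 g : E)).
have Eprecomp (h : X -> X) (p : E) (B : set E) : closed B ->
    (forall n, B (iter n.+1 h \o p)) ->
    forall r, closure (range (fun n => iter n.+1 h : E)) r -> B (r \o p).
  move=> Bcl Bh.
  apply: (@closure_sub_preimage _ _ (fun f : E => (f \o p : E))) => //.
    exact: ptws_precomp_continuous.
  by move=> _ [n _ <-]; exact: Bh.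
have Epost (h : X -> X) : continuous h ->
    forall r, closure (range (fun n => iter n.+1 h : E)) r ->
      closure (range (fun n => iter n.+1 h : E)) (h \o r).
  move=> hc.
  apply: (@closure_sub_preimage _ _ (fun f : E => (h \o f : E)) _
    (closure (range (fun n => iter n.+1 h : E)))).
  - exact: ptws_postcomp_continuous.
  - exact: closed_closure.
  - by move=> _ [n _ <-]; apply: subset_closure; exists n.+1.
pose P (B : set E) := forall p, B p -> B (t \o p).
have PI (F : set (set E)) : F `<=` P -> P (\bigcap_(B in F) B).
  by move=> FP p Fp B FB; apply: (FP B FB); apply: Fp.
have Ep0 : Ep !=set0 by exists t; apply: subset_closure; exists 0%N.
have [L [Lcl [l Ll] PL LE Lmin]] :=
  compact_minimal ptws_compact PI (@closed_closure _ _) Ep0 (Epost t tc).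
have iterL n p : L p -> L (iter n t \o p).
  by move=> Lp; elim: n => [//|n IH]; exact: (PL _ IH).
(* Stable under the powers of [t] and closed, [L] is stable under left composition with their
   limits, its own elements included. *)
have [u Lu uu] : exists2 u, L u & u \o u = u.
  apply: ellis_idempotent => //; first by exists l.
  move=> p q Lp Lq; apply: (Eprecomp t) => //; last exact: LE.
  by move=> n; exact: iterL.
(* The image of [L] is again closed and stable under [t], so minimality makes [t] act onto [L]; this
   is what lets [g] preserve [L]. *)
have tL : (fun f : E => (t \o f : E)) @` L = L.
  apply: Lmin.
  - by apply: ptws_closed_image => //; exact: ptws_postcomp_continuous.
  - by exists (t \o l); exists l.
  - by move=> _ [p Lp <-]; exists (t \o p) => //; exact: PL.
  - by move=> _ [p Lp <-]; exact: PL.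
have gL p : L p -> L (g \o p).
  rewrite -{1}tL => -[r Lr <-].
  suff -> : g \o (t \o r) = r by [].
  by apply/funext => x /=; rewrite tK.
have iterLg n : L (iter n g \o u).
  by elim: n => [//|n IH]; exact: (gL _ IH).
(* Composition with [t] carries tail [m.+1] into tail [m]. No single tail need be stable, but the
   intersection is, and minimality applies to it. *)
pose C m := closure [set (iter n g \o u : E) | n in [set n | (m <= n)%N]].
have CL : \bigcap_m C m = L.
  apply: Lmin.
  - by apply: closed_bigI => m _; exact: closed_closure.
  - have [||||p Cp] := @compact_directed_bigcap E (range C) ptws_compact.
    + by exists (C 0%N); exists 0%N.
    + move=> _ _ [m _ <-] [k _ <-]; exists (C (maxn m k)).
        by exists (maxn m k).
      rewrite subsetI; split; apply: closureS => _ [n /= mn <-]; exists n => //=.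
        exact: leq_trans (leq_maxl _ _) mn.
      exact: leq_trans (leq_maxr _ _) mn.
    + by move=> _ [m _ <-]; exact: closed_closure.
    + move=> _ [m _ <-]; exists (iter m g \o u); apply: subset_closure.
      by exists m => /=.
    + by exists p => m _; apply: Cp; exists m.
  - move=> p Cp m _; have := Cp m.+1 I; move: p {Cp}.
    apply: (@closure_sub_preimage _ _ (fun f : E => (t \o f : E)) _ (C m)).
    + exact: ptws_postcomp_continuous.
    + exact: closed_closure.
    + move=> _ [[//|n] /= mn <-]; apply: subset_closure; exists n => //.
      by apply/funext => x /=; rewrite gK.
  - move=> p /(_ 0%N I); apply: (@closure_sub_preimage _ _ idfun _ L) => //.
      by move=> r; exact: cvg_id.
    by move=> _ [n _ <-]; exact: iterLg.
have [q Eq qu] : ((fun f : E => (f \o u : E)) @` Em) u.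
  (* Tail 1 leaves out the zeroth power, as membership in [Em] demands. *)
  have := Lu; rewrite -CL => /(_ 1%N I).
  apply: (@closure_sub_preimage _ _ idfun _ ((fun f : E => (f \o u : E)) @` Em)).
  - by move=> r; exact: cvg_id.
  - apply: ptws_closed_image; last exact: closed_closure.
    exact: ptws_precomp_continuous.
  - move=> _ [[//|n] _ <-]; exists (iter n.+1 g) => //.
    by apply: subset_closure; exists n.
(* [q] itself need not be idempotent, but the elements of [Em] fixing [u] form a closed
   semigroup. *)
have [r [Er ru] rr] : exists2 r,
    (Em `&` (fun f : E => (f \o u : E)) @^-1` [set u]) r & r \o r = r.
  apply: ellis_idempotent.
  - apply: closedI; first exact: closed_closure.
    apply: (continuous_closedP _).1; last exact: ptws_closed_set1.
    exact: ptws_precomp_continuous.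
  - by exists q.
  - move=> p r [Ep' pu] [Er ru]; split.
      apply: (Eprecomp g) => //; first exact: closed_closure.
      move=> n; elim: n.+1 => [//|k IH]; exact: (Epost _ gc _ IH).
    rewrite /preimage /= in pu ru *.
    by rewrite -[LHS]/(p \o (r \o u)) ru.
by exists u, r; split => //; exact: LE.
Qed.

End pointwise_maps.

(** * Semiflows and proximal pairs *)

Section semiflows.
Variables (T : monoidType) (X : topologicalType) (f : semiflow T X).

Lemma semiflow_continuous (t : T) : continuous (f t).
Proof.
move=> x; apply: (@continuous_comp _ _ _ (fun x => (t : discrete_topology T, x))
  (fun p : discrete_topology T * X => f p.1 p.2)).
  move=> A [[U V] [/= Ut Vx] UVA]; apply: filterS Vx => w Vw.
  by apply: UVA; split => //=; exact: nbhs_singleton Ut.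
exact: sf_continuous.
Qed.

Lemma semiflow_iter (t : T) (n : nat) :
  exists s : T, forall x, iter n (f t) x = f s x.
Proof.
elim: n => [|n [s IH]]; first by exists 1%g => x; rewrite sf_act1.
by exists (t * s)%g => x; rewrite iterS IH sf_actM.
Qed.

Lemma proximal_nbhs (x x' z : X) :
  (forall U, nbhs z U -> exists t, U (f t x) /\ U (f t x')) ->
  proximal f x x'.
Proof.
move=> H.
(* Each index carries a neighbourhood of [z] with a time bringing both points into it; indices are
   ordered by reverse inclusion of neighbourhoods. *)
pose I := {i : set X * T | nbhs z i.1 /\ i.1 (f i.2 x) /\ i.1 (f i.2 x')}.
pose le (i j : I) := (sval j).1 `<=` (sval i).1.
have ex U : nbhs z U -> exists i : I, (sval i).1 = U.
  by move=> zU; have [t Ut] := H U zU; exists (exist _ (U, t) (conj zU Ut)).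
have tails (g : I -> X) :
    (forall i : I, (sval i).1 (g i)) -> g i @[i --> net_tails le] --> z.
  move=> gP U zU; have [i iU] := ex U zU.
  by exists i => // j /= ij; rewrite -iU; apply: ij; exact: gP.
exists I, le, (fun i => (sval i).2), z; split.
- split.
  + by have [i _] := ex setT filterT.
  + by move=> i.
  + by move=> i j k ij jk; exact: subset_trans jk ij.
  + move=> i j; have zi := (svalP i).1; have zj := (svalP j).1.
    have [k kE] := ex _ (filterI zi zj).
    by exists k; rewrite /le kE; split => w [].
- by apply: tails => i; have [_ []] := svalP i.
- by apply: tails => i; have [_ []] := svalP i.
Qed.

Lemma proximal_common_time (x x' : X) : proximal f x x' ->
  exists z : X, forall U, nbhs z U -> exists t, U (f t x) /\ U (f t x').
Proof.
move=> [I [le [t [z [[_ _ _ led] tx tx']]]]].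
exists z => U zU.
have [i _ iU] := tx U zU; have [j _ jU] := tx' U zU.
have [k [ik jk]] := led i j.
by exists (t k); split; [exact: iU|exact: jU].
Qed.

End semiflows.

Lemma proximal_image (T : monoidType) (X Y : topologicalType)
    (fX : semiflow T X) (fY : semiflow T Y) (phi : X -> Y) (x x' : X) :
  continuous phi -> (forall t x, phi (fX t x) = fY t (phi x)) ->
  proximal fX x x' -> proximal fY (phi x) (phi x').
Proof.
move=> phic phiE /proximal_common_time[z H].
apply: (@proximal_nbhs _ _ _ _ _ (phi z)) => U zU.
by have [t] := H _ (phic z U zU); rewrite /= !phiE; exists t.
Qed.

Lemma dense_closure (X : topologicalType) (A : set X) :
  dense A -> closure A = [set: X].
Proof.
move=> dA; apply/seteqP; split => // x _ B; rewrite nbhsE => -[W [Wo Wx] WB].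
have [w [Ww Aw]] := dA W (ex_intro _ x Wx) Wo.
by exists w; split => //; exact: WB.
Qed.

Lemma nbhs_diagonal_entourage (X : uniformType) (D : set (X * X)) (z : X) :
  entourage D -> nbhs (z, z) D.
Proof.
move=> entD; have entS := entourage_split_ent entD.
exists (xsection (split_ent D)^-1%relation z, xsection (split_ent D) z) => /=.
  by split; apply: nbhs_entourage => //; exact: entourage_inv.
move=> [a b] [/= /xsectionP az /xsectionP zb].
exact: (entourage_split z).
Qed.

Lemma iter_can (X : Type) (t g : X -> X) (n : nat) :
  cancel g t -> cancel (iter n g) (iter n t).
Proof. by move=> gK x; elim: n => [//|n IH]; rewrite iterSr /= gK. Qed.

Lemma entourages_eq (X : uniformType) (x x' : X) :
  hausdorff_space X ->
  (forall A, sym_entourage A -> A (x, x')) -> x = x'.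
Proof.
move=> hX H; apply: (close_eq hX).
rewrite entourage_close => A entA.
suff [] : (A `&` A^-1%relation) (x, x') by [].
apply: H; split; first exact: entourage_invI.
by apply/seteqP; split => -[a b] [].
Qed.

(** * Lifting distal points through the extension *)

Section equicontinuous_extension.
Variables (T : monoidType) (X : uniformType) (Y : topologicalType).
Variables (fX : semiflow T X) (fY : semiflow T Y) (phi : X -> Y).
Hypotheses (cX : compact [set: X]) (hX : hausdorff_space X).
Hypotheses (iX : sf_invertible fX) (iY : sf_invertible fY).
Hypotheses (mY : sf_minimal fY).
Hypothesis hphi : rel_equicontinuous_extension fX fY phi.
Local Notation E := {ptws X -> X}.

(** Since [u (u z) = u z], suitable powers of [t] bring [z] and [u z] together near [u z]. These
    points are proximal, and so are their images in [Y]. *)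
Lemma idempotent_fixes_distal_fibre (t : T) (u : E) (z : X) :
  closure (range (fun n => iter n.+1 (fX t) : E)) u -> u \o u = u ->
  distal_point fY (phi z) -> phi (u z) = phi z.
Proof.
move=> Eu uu dz; apply: contrapT => uz.
apply: (dz (phi (u z))) => //; first by rewrite dense_closure.
apply: proximal_image (ree_continuous hphi) (ree_equivariant hphi) _.
apply: (@proximal_nbhs _ _ _ _ _ (u z)) => U zU.
have uuz : u (u z) = u z by rewrite -[LHS]/((u \o u) z) uu.
have Uz := ptws_nbhs_eval zU.
have Uuz : nbhs u [set f : E | U (f (u z))] by apply: ptws_nbhs_eval; rewrite uuz.
have [_ [[n _ <-] [/= U1 U2]]] := Eu _ (filterI Uuz Uz).
have [s sE] := semiflow_iter fX t n.+1.
by exists s; rewrite -!sE.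
Qed.

(** Injectivity of [t] on [Y] suffices: it sends [phi (g w)] to [phi w]. *)
Lemma inverse_iter_fibre (t : T) (g : X -> X) (n : nat) (z z' : X) :
  cancel g (fX t) -> phi z = phi z' -> phi (iter n g z) = phi (iter n g z').
Proof.
move=> gK zz'; elim: n => [//|n IH] /=.
by apply: (bij_inj (iY t)); rewrite -!(ree_equivariant hphi) !gK.
Qed.

Lemma limit_of_inverses_fibre (t : T) (g : X -> X) (q : E) (z z' : X) :
  hausdorff_space Y -> cancel g (fX t) ->
  closure (range (fun n => iter n.+1 g : E)) q ->
  phi z = phi z' -> phi (q z) = phi (q z').
Proof.
move=> hY gK Eq zz'; apply: hY => A B Aqz Bqz'.
have Az := ptws_nbhs_eval (ree_continuous hphi Aqz).
have Bz' := ptws_nbhs_eval (ree_continuous hphi Bqz').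
have [_ [[n _ <-] [/= Ag Bg]]] := Eq _ (filterI Az Bz').
exists (phi (iter n.+1 g z)); split; first exact: Ag.
by rewrite (inverse_iter_fibre _ gK zz'); exact: Bg.
Qed.

(* Nearness of [g^n z] and [g^n z'], for a single [n] depending on the pair, is
   carried back to [z] and [z'] with a loss independent of [n]. *)
Lemma limit_of_inverses_expansive (g h : X -> X) (q : E) (z z' : X)
    (D A : set (X * X)) :
  continuous h -> closure (range (fun n => iter n.+1 g : E)) q ->
  (forall n, exists s, forall x, fX s (h (iter n.+1 g x)) = x) ->
  (forall x x', D (x, x') -> phi x = phi x' ->
     forall s, A (fX s x, fX s x')) ->
  phi z = phi z' -> nbhs (h (q z), h (q z')) D -> A (z, z').
Proof.
move=> hc Eq hs DA zz' [[U V] [/= Uq Vq] UVD].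
have Uz := ptws_nbhs_eval (hc _ _ Uq).
have Vz' := ptws_nbhs_eval (hc _ _ Vq).
have [_ [[n _ <-] [/= Ug Vg]]] := Eq _ (filterI Uz Vz').
have [s sK] := hs n.
rewrite -(sK z) -(sK z'); apply: DA; first by apply: UVD; split.
by apply: (bij_inj (iY s)); rewrite -!(ree_equivariant hphi) !sK.
Qed.

Lemma distal_point_lift (x : X) :
  hausdorff_space Y -> distal_point fY (phi x) -> distal_point fX x.
Proof.
move=> hY dx x' _ x'x px; apply: x'x.
have xx' : phi x' = phi x.
  apply: contrapT => ne; apply: (dx (phi x')) => //.
    by rewrite dense_closure.
  exact: proximal_image (ree_continuous hphi) (ree_equivariant hphi) px.
have [z zP] := proximal_common_time px.
apply: entourages_eq hX _ => A symA.
have [D [[entD _] DA]] := ree_equicontinuous hphi symA.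
(* The interior is taken so that [D] is a neighbourhood of the pair reached at time [t], leaving
   room to approximate that pair. [D] is fixed before [t], on which [g], [u] and [q] depend. *)
have [[U V] [/= Uz Vz] UVD] := nbhs_interior (nbhs_diagonal_entourage z entD).
have [t [[Utx' _] [_ Vtx]]] := zP _ (filterI Uz Vz).
have [g tK gK] := iX t.
have [u [q [Eu Eq uu qq qu]]] :=
  inverse_idempotents cX hX (@semiflow_continuous _ _ fX t) tK gK.
have qfix y : phi y = phi x -> q y = y.
  move=> yx.
  have uy : phi (u y) = phi y.
    by apply: (idempotent_fixes_distal_fibre Eu uu); rewrite yx.
  (* [q] maps [y] and [u y] into one fibre, and it fixes [u y]. *)
  have qy : phi (q y) = phi y.
    rewrite (limit_of_inverses_fibre hY gK Eq (esym uy)).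
    by rewrite -[q (u y)]/((q \o u) y) qu.
  apply: entourages_eq hX _ => B symB.
  have [D' [[entD' _] DB]] := ree_equicontinuous hphi symB.
  (* The pair is [(q y, y)], whose two points have the same image under [q]. *)
  apply: (limit_of_inverses_expansive (h := id) _ Eq _ DB qy).
  - by move=> w; exact: cvg_id.
  - move=> n; have [s sE] := semiflow_iter fX t n.+1.
    by exists s => w; rewrite -sE; exact: (iter_can n.+1 gK).
  - by rewrite -[q (q y)]/((q \o q) y) qq; exact: nbhs_diagonal_entourage.
(* Following [g^(n+1)] by [t] gives [g^n], which [t^n] undoes; the power of [g] must therefore be
   positive. *)
apply: (limit_of_inverses_expansive (@semiflow_continuous _ _ fX t) Eq _ DA xx').
  move=> n; have [s sE] := semiflow_iter fX t n.
  by exists s => w; rewrite -sE /= gK; exact: (iter_can n gK).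
by rewrite !qfix //; apply: UVD.
Qed.

End equicontinuous_extension.

Unset Implicit Arguments.

Theorem theorem1p24 (R : realType) (T : monoidType)
    (X : uniformType) (Y : topologicalType)
    (fX : semiflow T X) (fY : semiflow T Y) (phi : X -> Y)
    (hT : infinite_set [set: T]) (hA : amenable R T)
    (hX0 : [set: X] !=set0) (hXc : compact [set: X]) (hXh : hausdorff_space X)
    (hY0 : [set: Y] !=set0) (hYc : compact [set: Y]) (hYh : hausdorff_space Y)
    (hXm : sf_minimal fX) (hXi : sf_invertible fX)
    (hYm : sf_minimal fY) (hYi : sf_invertible fY)
    (hphi : rel_equicontinuous_extension fX fY phi)
    (hYd : point_distal fY) :
  point_distal fX /\
  (forall y : Y, distal_point fY y ->
     forall x : X, phi x = y -> distal_point fX x).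
Proof.
have lift y : distal_point fY y -> forall x, phi x = y -> distal_point fX x.
  by move=> dy x xy; apply: (distal_point_lift hXc hXh hXi hYi hYm hphi hYh);
    rewrite xy.
split=> //; have [y [dy _]] := hYd.
have [x _ xy] := ree_surjective hphi (I : [set: Y] y).
by exists x; split; [exact: lift dy x xy|exact: hXm].
Qed.
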